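(* Let $G$ be a graph on $n$ vertices such that its exact distance $t$-power $G^{[\sharp t]}$ is regular. Let $G^{[\sharp t]}$ have adjacency eigenvalues $\beta_1\ge\cdots\ge\beta_n$. Then the $t$-equidistant number of $G$ satisfies $$\mathrm{eq}_t(G)\le n\,\frac{1+\beta_2}{n-\beta_1+\beta_2}.$$
   Context: Here $t$ is a positive integer and $d(u,v)$ is the shortest-path distance in $G$. The exact distance $t$-power $G^{[\sharp t]}$ is the graph on the vertex set $V(G)$ in which two vertices are adjacent if and only if they are at distance exactly $t$ in $G$. A set $S\subseteq V(G)$ is $t$-equidistant if $d(u,v)=t$ for all distinct $u,v\in S$, and the $t$-equidistant number $\mathrm{eq}_t(G)$ is the number of vertices in a largest $t$-equidistant set of $G$. Adjacency eigenvalues are listed with multiplicity. *)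

(* Defs.v *)
From mathcomp Require Import all_boot all_order all_algebra.

Set Implicit Arguments.
Unset Strict Implicit.
Unset Printing Implicit Defensive.

Import Order.TTheory GRing.Theory Num.Theory.

Record sgraph := SGraph {
  vertex :> finType;
  edge : rel vertex;
  edge_sym : symmetric edge;
  edge_irrefl : irreflexive edge
}.

Definition walk (G : sgraph) (u v : G) (k : nat) : bool :=
  [exists p : k.-tuple G, path (@edge G) u p && (last u p == v)].

Lemma connect_walk (G : sgraph) (u v : G) :
  connect (@edge G) u v -> exists k, walk u v k.
Proof.
case/connectP=> p pp ->; exists (size p); apply/existsP.
by exists (in_tuple p); rewrite pp eqxx.
Qed.

(* [None] is the infinite distance between vertices of different components. *)
Definition dist (G : sgraph) (u v : G) : option nat :=
  if connect (@edge G) u v =P true is ReflectT uv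
  then Some (ex_minn (connect_walk uv)) else None.

Lemma distE (G : sgraph) (u v : G) (t : nat) :
  (dist u v == Some t) = walk u v t && [forall k : 'I_t, ~~ walk u v k].
Proof.
rewrite /dist; case: eqP => [uv|nuv].
  case: ex_minnP => m wm minm.
  apply/eqP/andP => [[<-]|[wt /forallP nw]].
    split=> //; apply/forallP=> k; apply/negP => /minm.
    by rewrite leqNgt ltn_ord.
  congr Some; apply/eqP; rewrite eqn_leq minm //= leqNgt.
  by apply/negP => ltmt; move: (nw (Ordinal ltmt)); rewrite wm.
apply/esym/negP => /andP[/existsP[p /andP[pp /eqP lp]] _].
by apply: nuv; apply/connectP; exists p.
Qed.

Lemma walk_sym (G : sgraph) (u v : G) k : walk u v k = walk v u k.
Proof.
suff imp (x y : G) : walk x y k -> walk y x k by apply/idP/idP; apply: imp.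
case/existsP=> p /andP[pxp /eqP <-]; apply/existsP.
have sz : size (rev (belast x p)) == k by rewrite size_rev size_belast size_tuple.
exists (Tuple sz) => /=; apply/andP; split.
  by rewrite rev_path; apply: sub_path pxp => a b; rewrite /= edge_sym.
case: {pxp sz} (tval p) => [|a s] //=.
by rewrite rev_cons last_rcons.
Qed.

Definition exact_rel (G : sgraph) (t : nat) : rel G :=
  fun u v => dist u v == Some t.

Lemma exact_rel_sym (G : sgraph) (t : nat) : symmetric (exact_rel (G := G) t).
Proof.
move=> u v; rewrite /exact_rel !distE walk_sym; congr (_ && _).
by apply: eq_forallb => k; rewrite walk_sym.
Qed.

Lemma exact_rel_irrefl (G : sgraph) (t : nat) :
  0 < t -> irreflexive (exact_rel (G := G) t).
Proof.
move=> t0 u; rewrite /exact_rel distE; apply/negP => /andP[_ /forallP nw].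
move: (nw (Ordinal t0)) => /negP[]; apply/existsP.
by exists [tuple] => /=; rewrite eqxx.
Qed.

Definition exact_power (G : sgraph) (t : nat) (t_gt0 : 0 < t) : sgraph :=
  SGraph (@exact_rel_sym G t) (@exact_rel_irrefl G t t_gt0).

Definition t_equidistant (G : sgraph) (t : nat) (S : {set G}) : bool :=
  [forall u in S, forall v in S, (u != v) ==> (dist u v == Some t)].

Definition eq_number (G : sgraph) (t : nat) : nat :=
  \max_(S : {set G} | t_equidistant t S) #|S|.

Definition regular (G : sgraph) : Prop :=
  exists k : nat, forall v : G, #|[set w | edge v w]| = k.

Local Open Scope ring_scope.

Definition adjacency (R : rcfType) (G : sgraph) : 'M[R]_#|G| :=
  \matrix_(i, j) (edge (enum_val i) (enum_val j))%:R.

(* Counting multiplicities in the characteristic polynomial forces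
   [size beta = #|G|]; the largest eigenvalue is [beta`_0]. *)
Definition adjacency_spectrum (R : rcfType) (G : sgraph) (beta : seq R) : Prop :=
  sorted >=%R beta /\
  char_poly (adjacency R G) = \prod_(b <- beta) ('X - b%:P).

(* Main.v *)
(* Ratio bound for cliques. A t-equidistant set S is a clique of the exact power,
   which is k-regular with adjacency matrix A, so beta_1 = k with the
   all-ones eigenvector 1. Since n 1_S - |S| 1 is orthogonal to 1, its Rayleigh
   quotient for A is at most beta_2; expanding both quadratic forms gives
   |S| (n - beta_1 + beta_2) <= n (1 + beta_2). Applied to a single vertex, this
   gives beta_2 >= -1, so the nonzero factor n - beta_1 + beta_2 is positive. *)
Require Import Defs.
From mathcomp Require Import all_boot all_order all_algebra.
From mathcomp Require Import spectral sesquilinear complex ring lra.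
Import Order.TTheory GRing.Theory Num.Theory.
Local Open Scope ring_scope.
Local Open Scope complex_scope.
Local Open Scope sesquilinear_scope.

(** * Diagonalization of real symmetric matrices *)

Lemma char_poly_conj {F : fieldType} {n : nat} (P A : 'M[F]_n) :
  P \in unitmx -> char_poly (invmx P *m A *m P) = char_poly A.
Proof.
move=> Pu; rewrite /char_poly.
have -> : char_poly_mx (invmx P *m A *m P) =
    map_mx polyC (invmx P) *m char_poly_mx A *m map_mx polyC P.
  rewrite /char_poly_mx !map_mxM mulmxBr mulmxBl; congr (_ - _).
  by rewrite mul_mx_scalar -scalemxAl -map_mxM mulVmx // map_mx1 scalemx1.
rewrite !det_mulmx mulrAC -det_mulmx -map_mxM mulVmx // map_mx1 det1 mul1r //.
Qed.

(* The eigenvalues are real but the diagonalizing basis is taken in R[i], where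
   the spectral theorem is available. *)
Lemma spectral_real_sym {R : rcfType} {n : nat} {A : 'M[R]_n} {beta : seq R} :
  A^T = A -> char_poly A = \prod_(b <- beta) ('X - b%:P) ->
  exists (P : 'M[R[i]]_n) (d : 'I_n -> R),
    [/\ P \is unitarymx,
        map_mx (real_complex R) A =
          P^t* *m diag_mx (\row_i (d i)%:C) *m P
      & perm_eq beta [seq d i | i : 'I_n]].
Proof.
move=> Asym Achar; set AC := map_mx _ A.
have herm : AC \is hermsymmx.
  apply/is_hermitianmxP; rewrite expr0 scale1r.
  apply/matrixP=> i j; rewrite !mxE -{1}Asym mxE.
  by rewrite /Num.conj /= oppr0.
have ACE := orthomx_spectralP (hermitian_normalmx herm).
set P := spectralmx AC in ACE; set s := spectral_diag AC in ACE.
have Pu : P \is unitarymx by exact: spectral_unitarymx.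
have charE : \prod_(b <- [seq b%:C | b <- beta]) ('X - b%:P)
           = \prod_(b <- [seq s 0 i | i : 'I_n]) ('X - b%:P).
  rewrite big_map big_image /=; transitivity (char_poly AC).
    rewrite /AC -map_char_poly Achar rmorph_prod.
    by apply: eq_bigr => b _; rewrite rmorphB /= map_polyX map_polyC.
  rewrite ACE char_poly_conj ?spectral_unit // char_poly_trig ?diag_mx_is_trig //.
  by apply: eq_bigr => i _; rewrite mxE eqxx.
(* Unique factorization matches the complex spectrum with the image of [beta], which is why every
   [s 0 i] is real. *)
have perm := prod_XsubC_eq charE.
have sreal i : s 0 i = (complex.Re (s 0 i))%:C.
  have : s 0 i \in [seq s 0 i | i : 'I_n] by apply: image_f.
  by rewrite -(perm_mem perm) => /mapP[b _ ->].
exists P, (fun i => complex.Re (s 0 i)); split=> //.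
  have -> : \row_i (complex.Re (s 0 i))%:C = s by apply/rowP=> i; rewrite mxE -sreal.
  by rewrite -(invmx_unitary Pu) -ACE.
apply: (perm_map_inj (@complexI R)); rewrite -map_comp.
by rewrite (eq_map (g := s 0)) // => i /=; rewrite -sreal.
Qed.

(** * Eigenvalue and Rayleigh quotient bounds *)

Lemma sorted_le_head {R : realDomainType} {s : seq R} {a : R} :
  sorted >=%R s -> a \in s -> a <= s`_0.
Proof.
case: s => [|b s] //=; rewrite (path_sortedE (rev_trans le_trans)).
case/andP=> /allP smax _; rewrite inE => /predU1P[->|/smax //]; exact: lexx.
Qed.

Lemma count_gt_second {R : realDomainType} {s : seq R} :
  sorted >=%R s -> (count (> s`_1)%R s <= 1)%N.
Proof.
case: s => [|b [|c s]] //= => [_|/andP[_ scs]]; first by case: (_ < _).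
rewrite ltxx add0n -[leqRHS]addn0 leq_add ?leq_b1 // leqNgt -has_count.
apply/hasPn=> a a_s; rewrite -leNgt.
by apply: (@sorted_le_head _ (c :: s) _); rewrite ?inE ?a_s ?orbT.
Qed.

(* At most one eigenvalue exceeds beta`_1; if there is one, [e] spans its
   eigenline, so [x] has no component along it. *)
Lemma rayleigh_orthogonal {R : rcfType} {n : nat} {A : 'M[R]_n} {beta : seq R}
    {e x : 'rV[R]_n} :
  A^T = A -> char_poly A = \prod_(b <- beta) ('X - b%:P) ->
  sorted >=%R beta -> e != 0 -> e *m A = beta`_0 *: e -> x *m e^T = 0 ->
  (x *m A *m x^T) 0 0 <= beta`_1 * (x *m x^T) 0 0.
Proof.
move=> Asym Achar sbeta e_neq0 eA xe0.
have [P [d [Pu ACE dE]]] := spectral_real_sym Asym Achar.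
(* [toC v] holds the coordinates of [v] in the orthonormal eigenbasis formed by the rows of [P]. *)
pose toC (v : 'rV[R]_n) := map_mx (real_complex R) v *m P^t*.
have toCK v : toC v *m P = map_mx (real_complex R) v by rewrite mulmxKtV.
have conj_real (v : 'rV[R]_n) : (map_mx (real_complex R) v)^t* = map_mx (real_complex R) v^T.
  by apply/matrixP=> i j; rewrite !mxE /Num.conj /= oppr0.
have toCt v : (toC v)^t* = P *m map_mx (real_complex R) v^T.
  by rewrite /toC trmx_mul map_mxM /= conj_real trmxCK.
have dotE v w : ((v *m w^T) 0 0)%:C = \sum_i toC v 0 i * (toC w 0 i)^*.
  have -> : ((v *m w^T) 0 0)%:C = (toC v *m (toC w)^t*) 0 0.
    rewrite toCt mulmxA toCK -map_mxM.
    by rewrite [RHS]mxE.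
  by rewrite mxE; apply: eq_bigr => i _; rewrite !mxE.
have formE v : ((v *m A *m v^T) 0 0)%:C =
    \sum_i (d i)%:C * (toC v 0 i * (toC v 0 i)^*).
  have -> : ((v *m A *m v^T) 0 0)%:C =
      (toC v *m diag_mx (\row_i (d i)%:C) *m (toC v)^t*) 0 0.
    rewrite toCt /toC -!mulmxA (mulmxA (P^t*)) (mulmxA _ P) -ACE.
    by rewrite -!map_mxM [RHS]mxE mulmxA.
  rewrite mxE; apply: eq_bigr => i _.
  by rewrite mul_mx_diag !mxE mulrAC mulrC.
have e_diag i : d i != beta`_0 -> toC e 0 i = 0.
  move=> di; have : toC e *m diag_mx (\row_i (d i)%:C) = (beta`_0)%:C *: toC e.
    have := congr1 (fun M => map_mx (real_complex R) M *m P^t*) eA.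
    rewrite map_mxM map_mxZ ACE !mulmxA /= mulmxtVK // => ->.
    by rewrite scalemxAl.
  move/matrixP/(_ 0 i); rewrite mul_mx_diag [RHS]mxE !mxE mulrC => /eqP.
  rewrite -subr_eq0 -mulrBl mulf_eq0 -rmorphB /= => /orP[|/eqP //].
  by rewrite (inj_eq (@complexI R) _ 0) subr_eq0 (negPf di).
have top_inj i j : beta`_1 < d i -> beta`_1 < d j -> i = j.
  move=> di dj; have := count_gt_second sbeta.
  rewrite (permP dE) count_map enumT.
  have -> : count (preim d (> beta`_1)) (Finite.enum 'I_n) = #|[pred i | beta`_1 < d i]|.
    by rewrite cardE /enum_mem size_filter.
  by move/card_le1_eqP; apply.
have y0 i : beta`_1 < d i -> toC x 0 i = 0.
  (* Any [j] with [d j = beta]_0[also satisfies]d j > beta[_1], so it equals [i] by [top_inj]. Hence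
     [e] lives on coordinate [i] alone, and [x *m e^T = 0] reduces to a single product. *)
  move=> di; have ej j : j != i -> toC e 0 j = 0.
    move=> ji; apply: e_diag; apply: contraNneq ji => djE.
    apply/eqP/top_inj => //; rewrite djE (lt_le_trans di) //.
    by apply: sorted_le_head => //; rewrite (perm_mem dE) image_f.
  have : toC x 0 i * (toC e 0 i)^* = 0.
    have := dotE x e; rewrite xe0 mxE (bigD1 i) //= big1 ?addr0 => [<- //|j /ej ->].
    by rewrite rmorph0 mulr0.
  move/eqP; rewrite mulf_eq0 fmorph_eq0 => /orP[/eqP //|/eqP ei].
  case/negP: e_neq0; rewrite -(map_mx_eq0 (real_complex R)) -toCK.
  suff -> : toC e = 0 by rewrite mul0mx.
  by apply/rowP=> j; rewrite [RHS]mxE; case: (eqVneq j i) => [->|/ej].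
rewrite -lecR rmorphM /= formE dotE mulr_sumr; apply: ler_sum => i _.
have [di|/y0 ->] := lerP (d i) (beta`_1); last by rewrite mul0r !mulr0.
by apply: ler_wpM2r; rewrite ?mul_conjC_ge0 ?lecR.
Qed.

(** Evaluate [v *m A = a *: v] at a coordinate [m] where [|v|] is largest: every term of the sum is
    at most [|A i m| * |v 0 m|], and [|v 0 m|] cancels. Columns are summed because eigenvectors are
    rows. *)
Lemma eigenvalue_norm_le {R : realFieldType} {n : nat} {A : 'M[R]_n} {k a : R} :
  (forall j, \sum_i `|A i j| <= k) -> eigenvalue A a -> `|a| <= k.
Proof.
move=> Ak /eigenvalueP[v vA v_neq0].
have /existsP[m0 vm0] : [exists i, v 0 i != 0].
  apply: contraNT v_neq0; rewrite negb_exists => /forallP v0.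
  by apply/eqP/rowP=> i; rewrite mxE; apply/eqP/negbNE/v0.
pose m := [arg max_(i > m0) `|v 0 i|]%O.
have vmax i : `|v 0 i| <= `|v 0 m| by rewrite /m; case: arg_maxP => // j _; apply.
have vm_gt0 : 0 < `|v 0 m| by rewrite (lt_le_trans _ (vmax m0)) // normr_gt0.
rewrite -(ler_pM2r vm_gt0) -normrM.
have -> : a * v 0 m = (v *m A) 0 m by rewrite vA mxE.
rewrite mxE (le_trans (ler_norm_sum _ _ _)) //.
rewrite (le_trans (y := (\sum_i `|A i m|) * `|v 0 m|)) //; last first.
  by rewrite ler_wpM2r // Ak.
by rewrite mulr_suml ler_sum // => i _; rewrite normrM mulrC ler_wpM2l.
Qed.

(** * Adjacency matrices of regular graphs *)

Lemma sum_enum_val {R : pzSemiRingType} {T : finType} (F : T -> R) :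
  \sum_v F v = \sum_(i < #|T|) F (enum_val i).
Proof. exact: reindex (onW_bij _ (enum_val_bij T)). Qed.

Lemma sum_edge {R : pzSemiRingType} {G : sgraph} (v : G) :
  \sum_(w : G) (edge v w)%:R = #|[set w | edge v w]|%:R :> R.
Proof.
rewrite -sum1dep_card natr_sum [RHS]big_mkcond /=.
by apply: eq_bigr => w _; case: (edge v w).
Qed.

Lemma adjacency_sym (R : rcfType) (G : sgraph) : (adjacency R G)^T = adjacency R G.
Proof. by apply/matrixP=> i j; rewrite !mxE edge_sym. Qed.

Lemma sum_adjacency_regular (R : rcfType) {G : sgraph} {k : nat} (j : 'I_#|G|) :
  (forall v : G, #|[set w | edge v w]| = k) ->
  \sum_i adjacency R G i j = k%:R.
Proof.
move=> Gk; rewrite -(Gk (enum_val j)) -sum_edge [RHS]sum_enum_val.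
by apply: eq_bigr => i _; rewrite mxE edge_sym.
Qed.

Lemma degree_lt_card {G : sgraph} (v : G) : (#|[set w | edge v w]| < #|G|)%N.
Proof.
rewrite -cardsT proper_card // properE subsetT; apply/subsetPn.
by exists v; rewrite ?inE ?edge_irrefl.
Qed.

Lemma ones_adjacency (R : rcfType) {G : sgraph} {k : nat} :
  (forall v : G, #|[set w | edge v w]| = k) ->
  const_mx 1 *m adjacency R G = k%:R *: (const_mx 1 : 'rV_#|G|).
Proof.
move=> Gk; apply/rowP=> j; rewrite !mxE mulr1 -(sum_adjacency_regular R j Gk).
by apply: eq_bigr => i _; rewrite mxE mul1r.
Qed.

Lemma const_mx1_neq0 (R : nzRingType) {n : nat} :
  (0 < n)%N -> (const_mx 1 : 'rV[R]_n) != 0.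
Proof.
move=> n_gt0; apply/eqP=> /rowP/(_ (Ordinal n_gt0)); rewrite !mxE => /eqP.
by rewrite oner_eq0.
Qed.

(** The all-ones vector puts [k] in the spectrum, and the column sum bound keeps every eigenvalue at
    most [k]. *)
Lemma regular_head {R : rcfType} {G : sgraph} {k : nat} {beta : seq R} :
  (forall v : G, #|[set w | edge v w]| = k) ->
  adjacency_spectrum G beta -> (0 < #|G|)%N ->
  beta`_0 = k%:R.
Proof.
move=> Gk [sbeta Achar] G_gt0.
have memE a : (a \in beta) = eigenvalue (adjacency R G) a.
  by rewrite eigenvalue_root_char Achar root_prod_XsubC.
have kb : k%:R \in beta.
  rewrite memE; apply/eigenvalueP; exists (const_mx 1); last exact: const_mx1_neq0.
  exact: ones_adjacency.
apply/le_anti/andP; split; last exact: sorted_le_head.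
apply: le_trans (ler_norm _) (@eigenvalue_norm_le _ _ (adjacency R G) _ _ _ _).
  move=> j; rewrite -(sum_adjacency_regular R j Gk) ler_sum // => i _.
  by rewrite mxE ger0_norm ?ler0n.
by rewrite -memE mem_nth // lt0n size_eq0; apply: contraTneq kb => ->.
Qed.

(** * The clique ratio bound and its use for equidistant sets *)

Lemma clique_ratio {R : rcfType} {G : sgraph} {k : nat} {beta : seq R}
    {S : {set G}} :
  (forall v : G, #|[set w | edge v w]| = k) ->
  adjacency_spectrum G beta -> (0 < #|G|)%N ->
  {in S &, forall u v, u != v -> edge u v} -> (0 < #|S|)%N ->
  #|S|%:R * (#|G|%:R - beta`_0 + beta`_1) <= #|G|%:R * (1 + beta`_1).
Proof.
move=> Gk Gbeta G_gt0 Scl S_gt0; have [sbeta Achar] := Gbeta.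
set A := adjacency R G; pose ones : 'rV[R]_#|G| := const_mx 1.
pose x : 'rV[R]_#|G| := \row_i (enum_val i \in S)%:R.
have sumS : \sum_(v : G) (v \in S)%:R = #|S|%:R :> R.
  rewrite -sum1_card natr_sum [RHS]big_mkcond /=.
  by apply: eq_bigr => v _; case: (v \in S).
have onesx : (ones *m x^T) 0 0 = #|S|%:R.
  rewrite mxE -sumS [RHS]sum_enum_val; apply: eq_bigr => i _.
  by rewrite !mxE mul1r.
have xx : (x *m x^T) 0 0 = #|S|%:R.
  rewrite mxE -sumS [RHS]sum_enum_val; apply: eq_bigr => i _.
  by rewrite !mxE -natrM mulnb andbb.
have oneone : (ones *m ones^T) 0 0 = #|G|%:R.
  rewrite mxE; under eq_bigr do rewrite !mxE mulr1.
  by rewrite sumr_const card_ord.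
have xones : (x *m ones^T) 0 0 = #|S|%:R.
  by rewrite -[x *m _]trmxK trmx_mul trmxK mxE.
(* The form counts ordered pairs of distinct vertices of [S], since all of these are edges. *)
have xAx : (x *m A *m x^T) 0 0 = #|S|%:R * (#|S|%:R - 1).
  transitivity (\sum_(v : G) \sum_(u : G) (u \in S)%:R * (edge u v)%:R * (v \in S)%:R : R).
    rewrite mxE [RHS]sum_enum_val; apply: eq_bigr => i _.
    rewrite !mxE [RHS]sum_enum_val mulr_suml; apply: eq_bigr => j _.
    by rewrite !mxE.
  rewrite -{1}sumS mulr_suml; apply: eq_bigr => v _.
  case vS: (v \in S); last by rewrite mul0r big1 // => u _; rewrite mulr0.
  rewrite mul1r -sumS [in RHS](bigD1 v) //= vS addrAC subrr add0r (bigD1 v) //=.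
  rewrite edge_irrefl mulr0 mul0r add0r; apply: eq_bigr => u uv.
  by case uS: (u \in S); rewrite ?mul0r // Scl // !mulr1.
have entry a b (M N : 'M[R]_1) : (a *: M - b *: N) 0 0 = a * M 0 0 - b * N 0 0.
  by rewrite !mxE.
(* Up to the factor [#|G|], this is the projection of [x] orthogonal to [ones], scaled to avoid
   division. *)
pose z := #|G|%:R *: x - #|S|%:R *: ones.
have zT : z^T = #|G|%:R *: x^T - #|S|%:R *: ones^T.
  by rewrite linearB /= !linearZ.
have z1 : z *m ones^T = 0.
  apply/matrixP=> i j; rewrite !ord1 [RHS]mxE mulmxBl -!scalemxAl entry.
  by rewrite xones oneone; ring.
have zx : (z *m x^T) 0 0 = #|G|%:R * #|S|%:R - #|S|%:R * #|S|%:R.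
  by rewrite mulmxBl -!scalemxAl entry xx onesx.
have zAx : (z *m A *m x^T) 0 0 =
    #|G|%:R * (#|S|%:R * (#|S|%:R - 1)) - #|S|%:R * (k%:R * #|S|%:R).
  rewrite mulmxBl -!scalemxAl (ones_adjacency R Gk) mulmxBl -!scalemxAl entry xAx.
  by rewrite [X in _ - _ * X]mxE onesx.
have zz : (z *m z^T) 0 0 = #|G|%:R * (z *m x^T) 0 0.
  by rewrite zT mulmxBr -!scalemxAr z1 scaler0 subr0 [LHS]mxE.
(* As [ones] is an eigenvector of the symmetric [A], [z *m A] is again orthogonal to [ones], so only
   the [x] part of the right factor survives. *)
have zAz : (z *m A *m z^T) 0 0 = #|G|%:R * (z *m A *m x^T) 0 0.
  have zA1 : z *m A *m ones^T = 0.
    rewrite -mulmxA -[A]adjacency_sym -trmx_mul (ones_adjacency R Gk) linearZ /=.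
    by rewrite -scalemxAr z1 scaler0.
  by rewrite zT mulmxBr -!scalemxAr zA1 scaler0 subr0 [LHS]mxE.
have eA : ones *m A = beta`_0 *: ones.
  by rewrite (regular_head Gk Gbeta) // (ones_adjacency R Gk).
have := rayleigh_orthogonal (adjacency_sym R G) Achar sbeta (const_mx1_neq0 R G_gt0) eA z1.
rewrite zAz zz zAx zx (regular_head Gk Gbeta) //.
have : 0 < #|G|%:R :> R by rewrite ltr0n.
have : 0 < #|S|%:R :> R by rewrite ltr0n.
move: (#|G|%:R : R) (#|S|%:R : R) (k%:R : R) (beta`_1) => n s c b s_gt0 n_gt0 H.
(* The Rayleigh inequality [H] is the claim multiplied by the positive factor [n * s], up to
   rearrangement. *)
rewrite -(ler_pM2l s_gt0) -(ler_pM2l n_gt0) -subr_ge0.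
rewrite -subr_ge0 in H; apply: le_trans H _; rewrite le_eqVlt; apply/orP; left.
by apply/eqP; ring.
Qed.

Lemma second_ge_N1 {R : rcfType} {G : sgraph} {k : nat} {beta : seq R} :
  (forall v : G, #|[set w | edge v w]| = k) ->
  adjacency_spectrum G beta -> (1 < #|G|)%N -> -1 <= beta`_1.
Proof.
move=> Gk Gbeta G_gt1; have G_gt0 := ltnW G_gt1.
pose v := enum_val (Ordinal G_gt0) : G.
have := @clique_ratio R G k beta [set v] Gk Gbeta G_gt0; rewrite cards1 mul1r mulrDr mulr1.
move=> /(_ _ isT) H; have {H}: #|G|%:R - beta`_0 + beta`_1 <= #|G|%:R + #|G|%:R * beta`_1.
  by apply: H => u w /set1P -> /set1P ->; rewrite eqxx.
have : k%:R + 1 <= #|G|%:R :> R.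
  by rewrite natr1 ler_nat -(Gk v) degree_lt_card.
have : 1 < #|G|%:R :> R by rewrite ltr1n.
rewrite (regular_head Gk Gbeta) //; nra.
Qed.

Theorem proposition21 (R : rcfType) (G : sgraph) (n t : nat) (t_gt0 : (0 < t)%N)
    (beta : seq R) :
  #|G| = n -> (1 < n)%N ->
  regular (exact_power G t_gt0) ->
  adjacency_spectrum (exact_power G t_gt0) beta ->
  n%:R - beta`_0 + beta`_1 != 0 ->
  (eq_number G t)%:R <= n%:R * ((1 + beta`_1) / (n%:R - beta`_0 + beta`_1)).
Proof.
move=> <- G_gt1 [k Gk] Gbeta ratio_neq0.
have G_gt0 := ltnW G_gt1.
have b1 := second_ge_N1 Gk Gbeta G_gt1.
have b0 := regular_head Gk Gbeta G_gt0.
have kn : k%:R + 1 <= #|G|%:R :> R.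
  by rewrite natr1 ler_nat -(Gk (enum_val (Ordinal G_gt0))) degree_lt_card.
have ratio_gt0 : 0 < #|G|%:R - beta`_0 + beta`_1 by rewrite lt0r ratio_neq0 b0; lra.
rewrite mulrA ler_pdivlMr //.
rewrite /eq_number; elim/big_ind: _ => [|a b|S /forall_inP S_eq].
- rewrite mul0r mulr_ge0 ?ler0n //; lra.
- by rewrite /maxn; case: ifP.
(* The empty set is treated apart because the ratio bound cancels [#|S|]. *)
have [->|S_neq0] := eqVneq #|S| 0%N.
  rewrite mul0r mulr_ge0 ?ler0n //; lra.
apply: (clique_ratio Gk Gbeta G_gt0); last by rewrite lt0n.
by move=> u v /S_eq /forall_inP uS /uS /implyP.
Qed.
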